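(* Let $K$ be an augmented directed complex with a loop-free unital basis $P$. Then the $\omega$-hypergraph $P$ associated to $K$ is a torsion-free complex.
   Context: Augmented directed complexes: an augmented directed complex (adc) $K$ consists of abelian groups $K_n$ with distinguished submonoids $K_n^*\subseteq K_n$ ($n\in\mathbb{N}$), group morphisms $d_n\colon K_{n+1}\to K_n$ and $e\colon K_0\to\mathbb{Z}$ with $e\circ d_0=0$ and $d_n\circ d_{n+1}=0$. A basis of $K$ is a graded set $P=\bigsqcup_nP_n$ with $P_n\subseteq K_n$ such that each $K^*_n$ is the free commutative monoid on $P_n$ and each $K_n$ is the free abelian group on $P_n$. Given a basis, $u\in K_n$ is written $u=\sum_{g\in P_n}u_gg$; $u\le v$ means $u_g\le v_g$ for all $g$; $u\wedge v=\sum_g\min(u_g,v_g)g$. For $u\in K_{n+1}$, $d^-u,d^+u\in K_n^*$ are the unique elements with $d_nu=d^+u-d^-u$ and $d^-u\wedge d^+u=0$. For $x\in P_n$, set $[x]_{n,-}=[x]_{n,+}=x$ and, for $j<n$, $[x]_{j,-}=d^-([x]_{j+1,-})$, $[x]_{j,+}=d^+([x]_{j+1,+})$. For $i\in\mathbb{N}$, $<_i$ is the smallest transitive relation on $P$ such that $u<_iv$ whenever $u\in P_k$, $v\in P_l$, $i<\min(k,l)$ and $[u]_{i,+}\wedge[v]_{i,-}\ne0$. The basis is unital if $e([x]_{0,-})=e([x]_{0,+})=1$ for all $x\in P$, and loop-free if every $<_i$ is irreflexive. The $\omega$-hypergraph associated to $K$ is the graded set $P$ with, for $x\in P_{n+1}$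 and $\epsilon\in\{-,+\}$, $x^\epsilon=\{y\in P_n\mid y\le d^\epsilon x\}$. An $\omega$-hypergraph is a set $P$ with a partition $P=\bigsqcup_{n\in\mathbb{N}}P_n$ together with, for $n\in\mathbb{N}$ and $u\in P_{n+1}$, two finite subsets $u^-,u^+\subseteq P_n$. For $U\subseteq P$ and $\epsilon\in\{-,+\}$, $U^\epsilon=\bigcup_{u\in U}u^\epsilon$; also $U^\mp=U^-\setminus U^+$ and $U^\pm=U^+\setminus U^-$. A subset $U\subseteq P_n$ is fork-free if either $n=0$ and $|U|=1$, or $n>0$ and $u^\epsilon\cap v^\epsilon=\emptyset$ for all distinct $u,v\in U$ and all $\epsilon\in\{-,+\}$. For $U\subseteq P_n$, $\triangleleft_U$ is the transitive closure of the relation on $U$ relating $u$ to $v$ when $n\ge 1$ and $u^+\cap v^-\neq\emptyset$; for $V,W\subseteq U$, $V\triangleleft_U W$ means $v\triangleleft_U w$ for some $v\in V$, $w\in W$; a subset $V\subseteq U$ is a segment for $\triangleleft_U$ if $u_1,u_3\in V$ and $u_1\triangleleft_U u_2\triangleleft_U u_3$ imply $u_2\in V$. An $n$-pre-cell of $P$ is a tuple $X=(X_{0,-},X_{0,+},\ldots,X_{n-1,-},X_{n-1,+},X_n)$ of finite subsets $X_{i,\epsilon}\subseteq P_i$, $X_n\subseteq P_n$; one writes $X_{n,-}=X_{n,+}=X_n$. A finite set $M\subseteq P_{i+1}$ moves a finite $U\subseteq P_i$ to a finite $V\subseteq P_i$ if $U=(V\cup M^-)\setminus M^+$ and $V=(U\cup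 M^+)\setminus M^-$. An $n$-cell is an $n$-pre-cell such that $X_{i+1,\epsilon}$ moves $X_{i,-}$ to $X_{i,+}$ for $0\le i<n$, $\epsilon\in\{-,+\}$, and every $X_{i,\epsilon}$ ($0\le i\le n$) is fork-free. For $u\in P_n$, the atom $\langle u\rangle$ is the $n$-pre-cell with $\langle u\rangle_{n,-}=\langle u\rangle_{n,+}=\{u\}$ and, for $j<n$, $\langle u\rangle_{j,-}=(\langle u\rangle_{j+1,-})^\mp$, $\langle u\rangle_{j,+}=(\langle u\rangle_{j+1,+})^\pm$. A torsion-free complex is an $\omega$-hypergraph $P$ satisfying: (non-emptiness) $u^-\ne\emptyset$ and $u^+\neq\emptyset$ for all $u\in P_n$, $n\ge1$; (acyclicity) $\triangleleft_{P_n}$ is irreflexive for all $n\geq1$; (relevance) $\langle u\rangle$ is a cell for all $u\in P$; (segment) for all $k\in\mathbb N$, $u\in P_k$, $n<k$, every $n$-cell $X$ and $\epsilon\in\{-,+\}$, if $\langle u\rangle_{n,\epsilon}\subseteq X_n$ then $\langle u\rangle_{n,\epsilon}$ is a segment for $\triangleleft_{X_n}$; (torsion-freeness) there are no $n,k,l\ge1$ with $n<\min(k,l)$, $u\in P_k$, $v\in P_l$ and $n$-cell $X$ with $\langle u\rangle_{n,+}\subseteq X_n$, $\langle v\rangle_{n,-}\subseteq X_n$, $\langle u\rangle_{n,+}\cap\langle v\rangle_{n,-}=\emptyset$, $\langle u\rangle_{n,+}\triangleleft_{X_n}\langle v\rangle_{n,-}$ and $\langle v\rangle_{n,-}\triangleleft_{X_n}\langle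 u\rangle_{n,+}$. *)

(* Defs.v *)
From HB Require Import structures.
From Stdlib Require Import Relation_Operators.
From mathcomp Require Import all_boot all_order all_algebra finmap.
From mathcomp Require Import boolp classical_sets functions cardinality.

Set Implicit Arguments.
Unset Strict Implicit.
Unset Printing Implicit Defensive.

Import Order.TTheory GRing.Theory Num.Theory.

Local Open Scope classical_set_scope.
Local Open Scope ring_scope.

Inductive sign : Set := Minus | Plus.

(** * Omega-hypergraphs *)

(* The partition [P = \bigsqcup_n P_n] is given by its dimension function.
   [face_dim] says that the faces of an element of [P_(n+1)] lie in [P_n]; it
   also makes the faces of an element of [P_0] empty. *)
Record hypergraph := Hypergraph {
  carrier :> Type;
  dim : carrier -> nat;
  face : sign -> carrier -> set carrier;
  face_finite : forall eps u, finite_set (face eps u);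
  face_dim : forall eps u v, face eps u v -> dim u = (dim v).+1 }.

Section Hypergraph.
Variable P : hypergraph.
Implicit Types (U V W M : set P) (u v w : P).

Definition grade (n : nat) : set P := [set u | dim u = n].

Definition faces (eps : sign) U : set P := \bigcup_(u in U) face eps u.

(* [border Minus U] is U^\mp and [border Plus U] is U^\pm. *)
Definition border (eps : sign) U : set P :=
  match eps with
  | Minus => faces Minus U `\` faces Plus U
  | Plus => faces Plus U `\` faces Minus U
  end.

Definition fork_free (n : nat) U : Prop :=
  match n with
  | 0%N => exists u, U = [set u]
  | _.+1 => forall u v, U u -> U v -> u <> v ->
            forall eps, face eps u `&` face eps v = set0
  end.

(* Nothing is related when [U] consists of elements of dimension 0, since these
   have no faces. *)
Definition triangle_step U u v : Prop :=
  [/\ U u, U v & face Plus u `&` face Minus v !=set0].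

Definition triangle U : P -> P -> Prop := clos_trans P (triangle_step U).

Definition triangle_set U V W : Prop :=
  exists v w, [/\ V v, W w & triangle U v w].

Definition segment U V : Prop :=
  V `<=` U /\ forall u1 u2 u3, V u1 -> V u3 ->
    U u2 -> triangle U u1 u2 -> triangle U u2 u3 -> V u2.

Definition moves M U V : Prop :=
  U = (V `|` faces Minus M) `\` faces Plus M /\
  V = (U `|` faces Plus M) `\` faces Minus M.

(* An n-pre-cell is a family whose members of index [i <= n] are as below; the
   members of index [i > n] carry no information. *)
Definition is_precell (n : nat) (X : nat -> sign -> set P) : Prop :=
  (forall i eps, (i <= n)%N ->
     finite_set (X i eps) /\ X i eps `<=` grade i) /\
  X n Minus = X n Plus.

Definition is_cell (n : nat) (X : nat -> sign -> set P) : Prop :=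
  [/\ is_precell n X,
      forall i eps, (i < n)%N -> moves (X i.+1 eps) (X i Minus) (X i Plus)
    & forall i eps, (i <= n)%N -> fork_free i (X i eps)].

(* The component X_n of an n-pre-cell, equal to X_{n,-} and to X_{n,+}. *)
Definition top (n : nat) (X : nat -> sign -> set P) : set P := X n Minus.

(* For [j <= dim u], take the border [dim u - j] times, starting from {u}. *)
Definition atom u (j : nat) (eps : sign) : set P :=
  iter (dim u - j) (border eps) [set u].

Record torsion_free_complex : Prop := TorsionFreeComplex {
  tf_nonempty : forall u eps, (0 < dim u)%N -> face eps u !=set0;
  tf_acyclic : forall n, (1 <= n)%N -> forall u, ~ triangle (grade n) u u;
  tf_relevant : forall u, is_cell (dim u) (atom u);
  tf_segment : forall u n X eps, (n < dim u)%N -> is_cell n X ->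
    atom u n eps `<=` top n X -> segment (top n X) (atom u n eps);
  tf_torsion_free : ~ exists n u v X,
    [/\ (1 <= n)%N, (n < minn (dim u) (dim v))%N & is_cell n X] /\
    [/\ atom u n Plus `<=` top n X,
        atom v n Minus `<=` top n X,
        atom u n Plus `&` atom v n Minus = set0,
        triangle_set (top n X) (atom u n Plus) (atom v n Minus)
      & triangle_set (top n X) (atom v n Minus) (atom u n Plus)] }.

End Hypergraph.

(** * Augmented directed complexes *)

Record adc := Adc {
  chain :> nat -> zmodType;
  chain_pos : forall n, set (chain n);
  bd : forall n, {additive chain n.+1 -> chain n};
  aug : {additive chain 0 -> int};
  chain_pos0 : forall n, chain_pos (0 : chain n);
  chain_posD : forall n (u v : chain n),
    chain_pos u -> chain_pos v -> chain_pos (u + v);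
  aug_bd : forall u, aug (bd 0 u) = 0;
  bd_bd : forall n u, bd n (bd n.+1 u) = 0 }.

Arguments bd {K} n : rename.
Arguments aug {K} : rename.
Arguments chain_pos K n : clear implicits, rename.

Section Basis.
Variable K : adc.

Definition graded_set := forall n, set (K n).

Variable P : graded_set.
Arguments P n : clear implicits.

Definition int_comb n (c : {fsfun P n -> int with 0}) : K n :=
  \sum_(g <- finsupp c) val g *~ c g.

Definition nat_comb n (c : {fsfun P n -> nat with 0%N}) : K n :=
  \sum_(g <- finsupp c) val g *+ c g.

(* The canonical map from the free abelian group (resp. free commutative
   monoid) on [P n] is bijective onto K_n (resp. onto K_n^* ). *)
Definition is_basis : Prop := forall n,
  [/\ bijective (@int_comb n),
      injective (@nat_comb n)
    & range (@nat_comb n) = chain_pos K n].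

(* The coefficients of [u], unique when [P] is a basis. *)
Definition coefs n (u : K n) : {fsfun P n -> int with 0} :=
  xget [fsfun] [set c | int_comb c = u].

Definition chain_le n (u v : K n) : Prop :=
  forall g : P n, coefs u g <= coefs v g.

(* Both coefficients vanish outside the union of the supports. *)
Definition meet n (u v : K n) : K n :=
  int_comb [fsfun g in (finsupp (coefs u) `|` finsupp (coefs v))%fset =>
            Num.min (coefs u g) (coefs v g)].

(* The pair (d^- u, d^+ u), unique when [P] is a basis. *)
Definition bd_parts n (u : K n.+1) : K n * K n :=
  xget (0, 0) [set p : K n * K n |
    [/\ chain_pos K n p.1, chain_pos K n p.2,
        bd n u = p.2 - p.1 & meet p.1 p.2 = 0]].

Definition bd_sign (eps : sign) n (u : K n.+1) : K n :=
  match eps with Minus => (bd_parts u).1 | Plus => (bd_parts u).2 end.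

(* [bracket j eps x] is [x]_{j,eps}; the degree of [x] is written [k + j], with
   [k] the number of times d^eps is applied. *)
Fixpoint bracket (j : nat) (eps : sign) (k : nat) : K (k + j)%N -> K j :=
  match k with
  | 0%N => fun x => x
  | k'.+1 => fun x => bracket eps (bd_sign eps (x : K (k' + j).+1))
  end.

(* The disjoint union of the [P n]. *)
Definition total : Type := {n : nat & P n}.

Definition in_total n (x : P n) : total := existT (fun n => P n) n x.

(* The degrees greater than [i] are those of the form [k.+1 + i]. *)
Inductive lt_step (i : nat) : total -> total -> Prop :=
  LtStep (k l : nat) (u : P (k.+1 + i)%N) (v : P (l.+1 + i)%N) :
    meet (bracket Plus (val u)) (bracket Minus (val v)) <> 0 ->
    lt_step i (in_total u) (in_total v).

Definition lt_basis (i : nat) : total -> total -> Prop :=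
  clos_trans total (lt_step i).

Definition unital : Prop := forall k (x : P (k + 0)%N),
  aug (bracket Minus (val x)) = 1 /\ aug (bracket Plus (val x)) = 1.

Definition loop_free : Prop := forall i x, ~ lt_basis i x x.

Definition total_dim (x : total) : nat := projT1 x.

Definition total_face (eps : sign) (x : total) : set total :=
  match x with
  | existT 0%N _ => set0
  | existT n.+1 x' =>
      [set in_total y | y in
        [set y : P n | chain_le (val y) (bd_sign eps (val x'))]]
  end.

Lemma total_face_dim eps u v :
  total_face eps u v -> total_dim u = (total_dim v).+1.
Proof. by case: u => -[|n] x //= [y _ <-]. Qed.

Lemma coefsK (hP : is_basis) n c : coefs (@int_comb n c) = c.
Proof.
have [/bij_inj inj _ _] := hP n.
by apply: xget_unique => // c' /inj.
Qed.

Lemma coefs_basis (hP : is_basis) n (g : P n) : coefs (val g) g = 1.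
Proof.
pose c : {fsfun P n -> int with 0} := [fsfun h in [fset g]%fset => 1].
have cg : c g = 1 by rewrite /c fsfunE inE eqxx.
have -> : val g = int_comb c.
  rewrite /int_comb (_ : finsupp c = [fset g]%fset).
    by rewrite big_seq_fset1 cg mulr1z.
  apply/fsetP => h; rewrite mem_finsupp /c fsfunE inE.
  by case: (h == g).
by rewrite coefsK.
Qed.

Lemma total_face_finite (hP : is_basis) eps u : finite_set (total_face eps u).
Proof.
case: u => -[|n] x; first exact: finite_set0.
apply: finite_image; set w := bd_sign _ _.
apply: sub_finite_set (finite_fset (finsupp (coefs w))) => y /(_ y).
rewrite coefs_basis // => le1 /=.
by rewrite mem_finsupp gt_eqF // (lt_le_trans ltr01 le1).
Qed.

Definition hypergraph_of (hP : is_basis) : hypergraph :=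
  Hypergraph (total_face_finite hP) total_face_dim.

End Basis.

(* Main.v *)
(** By induction on the dimension, the top chain of every cell of the
omega-category of [K] has coefficients at most 1, and so has the sum of the
sources (or targets) of its elements, counted with multiplicity. For if some
[p] occurs twice in that sum, execute only the elements lying below those with
[p] in their target: by loop-freeness this yields a cell of one dimension less,
in which [p] has a coefficient at least 2. Hence atoms are the supports of the
chains [x]_{j,eps}, and they are fork-free cells.

For the segment and torsion-freeness conditions, collapse the given atoms in
the fork-free set [X_n] to single points. A path for the triangle relation
becomes a path for [<_{n-1}], as it can only leave an atom <u>_{n,eps} through
<u>_{n-1,+} and enter it through <u>_{n-1,-}; a path that violates the
condition becomes a cycle. *)

From HB Require Import structures.
From Stdlib Require Import Relation_Operators.
From mathcomp Require Import all_boot all_order all_algebra finmap.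
From mathcomp Require Import boolp classical_sets functions cardinality zify.
Require Import Defs.

Set Implicit Arguments.
Unset Strict Implicit.
Unset Printing Implicit Defensive.

Import Order.TTheory GRing.Theory Num.Theory.

Local Open Scope classical_set_scope.
Local Open Scope ring_scope.

Local Arguments bd_sign : simpl never.

(** * Coefficients with respect to the basis *)

Section Coefficients.
Variables (K : adc) (P : graded_set K) (hP : is_basis P).
Arguments P n : clear implicits.

Definition coef n (g : P n) (u : K n) : int := coefs P u g.

Lemma int_comb_coefs n (u : K n) : int_comb (coefs P u) = u.
Proof.
have [[f _ fK] _ _] := hP n.
by rewrite -{1}(fK u) coefsK.
Qed.

Lemma coef_inj n (u v : K n) :
  (forall g : P n, coef g u = coef g v) -> u = v.
Proof.
move=> E; rewrite -(int_comb_coefs u) -(int_comb_coefs v); congr int_comb.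
by apply/fsfunP => g; exact: E.
Qed.

Lemma coef_comb n (A : {fset P n}) (f : P n -> int) g :
  coef g (\sum_(h <- A) val h *~ f h) = if g \in A then f g else 0.
Proof.
pose c : {fsfun P n -> int with 0} := [fsfun h in A => f h].
have cE h : c h = if h \in A then f h else 0 by rewrite /c fsfunE.
rewrite -cE (_ : \sum_(h <- A) _ = int_comb c).
  by rewrite /coef coefsK.
rewrite /int_comb; symmetry.
transitivity (\sum_(h <- A) val h *~ c h).
  apply: big_fset_incl => [|h _ hN]; last first.
    by rewrite (fsfun_dflt hN) mulr0z.
  apply/fsubsetP => h; rewrite mem_finsupp cE.
  by case: ifP => //; rewrite eqxx.
by apply: eq_big_seq => h hA; rewrite cE hA.
Qed.

Lemma coef_is_additive n (g : P n) : {morph coef g : u v / u - v}.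
Proof.
move=> u v; pose A := (finsupp (coefs P u) `|` finsupp (coefs P v))%fset.
have E w : (finsupp (coefs P w) `<=` A)%fset ->
    w = \sum_(h <- A) val h *~ coef h w.
  move=> sA; rewrite -[LHS]int_comb_coefs /int_comb.
  by apply: big_fset_incl => // h _ hN; rewrite (fsfun_dflt hN) mulr0z.
rewrite {1}(E u) ?fsubsetUl // {1}(E v) ?fsubsetUr // -sumrB.
under eq_bigr do rewrite -mulrzBr.
rewrite coef_comb; case: ifP => // gA.
have z w : (finsupp (coefs P w) `<=` A)%fset -> coef g w = 0.
  move=> sA; apply: fsfun_dflt; apply/negP => /(fsubsetP sA).
  by rewrite gA.
by rewrite !z ?subrr // ?fsubsetUl ?fsubsetUr.
Qed.

HB.instance Definition _ n (g : P n) :=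
  GRing.isZmodMorphism.Build (K n) int (coef g) (coef_is_additive g).

Lemma coef_basis n (g h : P n) : coef g (val h) = (g == h)%:R.
Proof.
have /= := coef_comb [fset h]%fset (fun=> 1) g.
by rewrite big_seq_fset1 mulr1z inE => ->; case: (g == h).
Qed.

Lemma chain_posP n (u : K n) :
  chain_pos K n u <-> forall g : P n, 0 <= coef g u.
Proof.
have [_ _ <-] := hP n; split=> [[c _ <-] g|pos].
  have -> : nat_comb c = \sum_(h <- finsupp c) val h *~ (c h)%:Z by [].
  by rewrite coef_comb; case: ifP.
exists [fsfun g in finsupp (coefs P u) => `|coef g u|%N] => //.
rewrite -[RHS]int_comb_coefs /int_comb /nat_comb.
set c := [fsfun _ in _ => _].
have cE h : (c h)%:Z = coef h u.
  rewrite /c fsfunE; case: ifP => [_|/negbT/fsfun_dflt]; first by rewrite gez0_abs.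
  by rewrite /coef => ->.
transitivity (\sum_(h <- finsupp c) val h *~ coef h u).
  by apply: eq_bigr => h _; rewrite -cE.
suff -> : finsupp c = finsupp (coefs P u) by [].
by apply/fsetP => h; rewrite !mem_finsupp -/(coef h u) -cE.
Qed.

Lemma coef_meet n (u v : K n) (g : P n) :
  coef g (meet P u v) = Num.min (coef g u) (coef g v).
Proof.
rewrite /coef /meet coefsK // fsfunE; case: ifP => // /negbT.
rewrite inE negb_or => /andP[/fsfun_dflt -> /fsfun_dflt ->].
by rewrite minxx.
Qed.

(** * Signed boundaries and fluxes *)

Lemma bd_partsP n (u : K n.+1) :
  [/\ chain_pos K n (bd_parts P u).1, chain_pos K n (bd_parts P u).2,
      bd n u = (bd_parts P u).2 - (bd_parts P u).1
    & meet P (bd_parts P u).1 (bd_parts P u).2 = 0].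
Proof.
rewrite /bd_parts; set Q := [set _ | _].
suff [p Qp] : exists p, Q p by exact: (xgetPex _ (ex_intro _ p Qp)).
pose w := bd n u; pose A := finsupp (coefs P w).
pose part (f : int -> int) := \sum_(h <- A) val h *~ f (coef h w).
have E f g : f 0 = 0 -> coef g (part f) = f (coef g w).
  move=> f0; rewrite coef_comb; case: ifP => // /negbT/fsfun_dflt.
  by rewrite /coef => ->.
(* The coefficientwise negative and positive parts of [bd n u]. *)
exists (part (fun z => Num.max 0 (- z)), part (Num.max 0)); split => /=.
- by apply/chain_posP => g; rewrite E ?oppr0 ?maxxx // le_max lexx.
- by apply/chain_posP => g; rewrite E ?maxxx // le_max lexx.
- apply: coef_inj => g; rewrite raddfB /= !E ?oppr0 ?maxxx // -/w.
  lia.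
- apply: coef_inj => g; rewrite coef_meet !E ?oppr0 ?maxxx // raddf0.
  lia.
Qed.

Lemma bd_sign_ge0 eps n (u : K n.+1) (g : P n) : 0 <= coef g (bd_sign P eps u).
Proof. by have [/chain_posP + /chain_posP + _ _] := bd_partsP u; case: eps. Qed.

Lemma bd_signE n (u : K n.+1) :
  bd n u = bd_sign P Plus u - bd_sign P Minus u.
Proof. by have [] := bd_partsP u. Qed.

Lemma bd_sign_disjoint n (u : K n.+1) (g : P n) :
  Num.min (coef g (bd_sign P Minus u)) (coef g (bd_sign P Plus u)) = 0.
Proof. by have [_ _ _ m0] := bd_partsP u; rewrite -coef_meet m0 raddf0. Qed.

Lemma eq_bd_sign eps n (u v : K n.+1) :
  bd n u = bd n v -> bd_sign P eps u = bd_sign P eps v.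
Proof. by move=> E; rewrite /bd_sign /bd_parts E. Qed.

Lemma sum_coef n (u : K n) :
  u = \sum_(g <- finsupp (coefs P u)) val g *~ coef g u.
Proof. by rewrite -[LHS]int_comb_coefs. Qed.

(** Counts [p] in the faces of the basis elements of [x] with multiplicity, before the cancellation
    that takes place in [bd_sign P eps x]. *)
Definition flux eps n (x : K n.+1) (p : P n) : int :=
  \sum_(g <- finsupp (coefs P x)) coef g x * coef p (bd_sign P eps (val g)).

Lemma coef_bd_sum n (A : {fset P n.+1}) (f : P n.+1 -> int) (p : P n) :
  coef p (bd n (\sum_(g <- A) val g *~ f g)) =
  \sum_(g <- A) f g * (coef p (bd_sign P Plus (val g)) -
                       coef p (bd_sign P Minus (val g))).
Proof.
rewrite !raddf_sum; apply: eq_bigr => g _.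
by rewrite !raddfMz bd_signE raddfB mulrC -mulrzz.
Qed.

Lemma coef_bd n (x : K n.+1) (p : P n) :
  coef p (bd n x) = flux Plus x p - flux Minus x p.
Proof.
rewrite {1}(sum_coef x) coef_bd_sum -sumrB.
by apply: eq_bigr => g _; rewrite mulrBr.
Qed.

Lemma flux_ge0 eps n (x : K n.+1) (p : P n) :
  chain_pos K n.+1 x -> 0 <= flux eps x p.
Proof.
move/chain_posP => pos; rewrite /flux.
by apply: sumr_ge0 => g _; rewrite mulr_ge0 // bd_sign_ge0.
Qed.

Lemma flux_ge_term eps n (x : K n.+1) (p : P n) (g : P n.+1) :
  chain_pos K n.+1 x ->
  coef g x * coef p (bd_sign P eps (val g)) <= flux eps x p.
Proof.
move/chain_posP => pos; rewrite /flux.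
have pos' h : 0 <= coef h x * coef p (bd_sign P eps (val h)).
  by rewrite mulr_ge0 // bd_sign_ge0.
case: (boolP (g \in finsupp (coefs P x))) => [gA|/fsfun_dflt g0].
  by rewrite (big_fsetD1 g) //= lerDl sumr_ge0.
by rewrite {1}/coef g0 mul0r sumr_ge0.
Qed.

Lemma flux_ge_two_terms eps n (x : K n.+1) (p : P n) (g h : P n.+1) :
  chain_pos K n.+1 x -> g <> h ->
  coef g x * coef p (bd_sign P eps (val g)) +
  coef h x * coef p (bd_sign P eps (val h)) <= flux eps x p.
Proof.
move=> posx gh; have /chain_posP pos := posx.
have pos' k : 0 <= coef k x * coef p (bd_sign P eps (val k)).
  by rewrite mulr_ge0 // bd_sign_ge0.
case: (boolP (g \in finsupp (coefs P x))) => [gA|/fsfun_dflt g0]; last first.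
  by rewrite {1}/coef g0 mul0r add0r flux_ge_term.
case: (boolP (h \in finsupp (coefs P x))) => [hA|/fsfun_dflt h0]; last first.
  by rewrite {3}/coef h0 mul0r addr0 flux_ge_term.
rewrite /flux (big_fsetD1 g) //= lerD2l (big_fsetD1 h) /=; last first.
  by rewrite !inE hA andbT; apply/eqP => /esym.
by rewrite lerDl sumr_ge0.
Qed.

(** * Globes and cellular chains *)

(** Recursion on the degree itself avoids the form [k + 0] imposed by [bracket]. *)
Fixpoint aug_down eps n : K n -> int :=
  match n with
  | 0%N => fun x => aug x
  | _.+1 => fun x => aug_down eps (bd_sign P eps x)
  end.

Lemma aug_bracket eps k (x : K (k + 0)%N) :
  aug (bracket P eps x) = aug_down eps x.
Proof. by elim: k x => [|k IH] x //=; rewrite IH. Qed.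

Lemma bd_sign0 eps n : bd_sign P eps (0 : K n.+1) = 0.
Proof.
apply: coef_inj => g; rewrite raddf0.
have := bd_sign_disjoint (0 : K n.+1) g; have := bd_signE (0 : K n.+1).
move/(congr1 (coef g)); rewrite !raddf0 raddfB /=.
by case: eps; lia.
Qed.

Lemma aug_down0 eps n : aug_down eps (0 : K n) = 0.
Proof. by elim: n => [|n IH] /=; rewrite ?raddf0 // bd_sign0. Qed.

Lemma bd_bd_sign eps eps' n (x : K n.+2) :
  bd n (bd_sign P eps x) = bd n (bd_sign P eps' x).
Proof.
have := congr1 (bd n) (bd_signE x).
rewrite bd_bd raddfB => /esym/eqP; rewrite subr_eq0 => /eqP E.
by case: eps; case: eps'.
Qed.

(** A property of basis elements that passes to their iterated borders. The augmentation condition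
    keeps these from vanishing. *)
Definition globe n (x : K n) :=
  chain_pos K n x /\ forall eps, aug_down eps x = 1.

Lemma globe_neq0 n (x : K n) : globe x -> exists g : P n, coef g x <> 0.
Proof.
case=> _ /(_ Plus) a1; apply: contrapT => no.
suff x0 : x = 0 by move: a1; rewrite x0 aug_down0.
apply: coef_inj => g; rewrite raddf0; apply: contrapT => g0.
by apply: no; exists g.
Qed.

(** Since [bd_sign] depends only on [bd], globularity lets the inner sign of
    [bd_sign P eps' (bd_sign P eps x)] be changed to [eps'], which removes mixed signs. *)
Lemma globe_bd_sign eps n (x : K n.+1) : globe x -> globe (bd_sign P eps x).
Proof.
case=> _ a1; split; first by apply/chain_posP => g; apply: bd_sign_ge0.
move=> eps'; case: n x a1 => [|n] x a1; first exact: (a1 eps).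
by rewrite /= (eq_bd_sign _ (bd_bd_sign eps eps' x)); exact: a1.
Qed.

Lemma globe_bracket eps j k (x : K (k + j)%N) :
  globe x -> globe (bracket P eps x).
Proof. by elim: k x => [|k IH] x //= gx; apply/IH/globe_bd_sign. Qed.

(* Whether [x] is the top of a cell of the omega-category of [K]. *)
Fixpoint cellular n : K n -> Prop :=
  match n with
  | 0%N => fun x => chain_pos K 0 x /\ aug x = 1
  | n'.+1 => fun x => chain_pos K n'.+1 x /\
      exists a b, [/\ cellular a, cellular b & bd n' x = b - a]
  end.

Lemma cellular_pos n (x : K n) : cellular x -> chain_pos K n x.
Proof. by case: n x => [|n] x []. Qed.

Lemma globe_cellular n (x : K n) : globe x -> cellular x.
Proof.
elim: n x => [|n IH] x gx; first by case: gx => px /(_ Plus).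
split; first by case: gx.
exists (bd_sign P Minus x), (bd_sign P Plus x).
by rewrite -bd_signE; split => //; apply/IH/globe_bd_sign.
Qed.

(** Adding a boundary changes neither the boundary of [a] nor, in degree 0, its augmentation, so
    only positivity can fail. *)
Lemma cellular_shift n (a : K n) s :
  cellular a -> chain_pos K n (a + bd n s) -> cellular (a + bd n s).
Proof.
case: n a s => [|n] a s [pa ca] py; split=> //.
  by rewrite raddfD /= aug_bd addr0.
by case: ca => a' [b' [? ? E]]; exists a', b'; rewrite raddfD /= bd_bd addr0.
Qed.

(** * Loop-freeness bounds the coefficients by 1 *)

Variables (hu : unital P) (hl : loop_free P).

Lemma globe_basis n (g : P n) : globe (val g).
Proof.
split; first by apply/chain_posP => h; rewrite coef_basis; case: (_ == _).
move=> eps; move: n g; suff H k (g : P (k + 0)%N) : aug_down eps (val g) = 1.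
  by move=> n; rewrite -[n]addn0; apply: H.
by rewrite -aug_bracket; case: eps; have [] := hu g.
Qed.

Lemma meet_neq0 n (u v : K n) (p : P n) :
  chain_pos K n u -> chain_pos K n v ->
  coef p u <> 0 -> coef p v <> 0 -> meet P u v <> 0.
Proof.
move=> /chain_posP pu /chain_posP pv u0 v0 m0.
have := coef_meet u v p; rewrite m0 raddf0.
by have := pu p; have := pv p; lia.
Qed.

Lemma lt_step_face n (g h : P n.+1) (p : P n) :
  coef p (bd_sign P Plus (val g)) <> 0 ->
  coef p (bd_sign P Minus (val h)) <> 0 ->
  lt_step n (in_total g) (in_total h).
Proof.
move=> gp hp; apply: (@LtStep _ P n 0 0 g h).
by apply: (meet_neq0 _ _ gp hp); apply/chain_posP => q; apply: bd_sign_ge0.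
Qed.

(* Execute only the cells of [x] preceding one with [p] in its target: by
   loop-freeness this yields a cell containing [p] with coefficient
   [coef p a + flux Plus x p]. *)
Lemma cellular_flux_le1 n (x : K n.+1) a b (p : P n) :
  (forall y : K n, cellular y -> forall q : P n, coef q y <= 1) ->
  chain_pos K n.+1 x -> cellular a -> cellular b -> bd n x = b - a ->
  coef p a + flux Plus x p <= 1.
Proof.
move=> le1 px ca cb E; have /chain_posP pos := px.
have /chain_posP posa := cellular_pos ca.
have /chain_posP posb := cellular_pos cb.
pose S (g : P n.+1) := exists h : P n.+1,
  coef p (bd_sign P Plus (val h)) <> 0 /\
  (g = h \/ lt_basis n (in_total g) (in_total h)).
have S_down (g h : P n.+1) (q : P n) : S g ->
    coef q (bd_sign P Plus (val h)) <> 0 ->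
    coef q (bd_sign P Minus (val g)) <> 0 -> S h.
  move=> [k [kp gk]] hq gq; exists k; split=> //; right.
  have hg := t_step _ _ _ _ (lt_step_face hq gq).
  by case: gk => [<- //|gk]; apply: t_trans hg gk.
pose f g := if `[< S g >] then coef g x else 0.
pose A := finsupp (coefs P x).
pose s := \sum_(g <- A) val g *~ f g.
pose d q (g : P n.+1) := coef q (bd_sign P Plus (val g)) -
                         coef q (bd_sign P Minus (val g)).
have dp q g : coef q (bd_sign P Minus (val g)) = 0 -> 0 <= d q g.
  by move=> z; rewrite /d z subr0 bd_sign_ge0.
have ys q : coef q (a + bd n s) = coef q a + \sum_(g <- A) f g * d q g.
  by rewrite raddfD /= coef_bd_sum.
have py : chain_pos K n (a + bd n s).
  apply/chain_posP => q; rewrite ys.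
  (* If an executed element has [q] in its source, all those with [q] in their target are executed
     too; the rest can only lower the coefficient, which is thus at least [coef q b]. Otherwise
     nothing executed consumes [q], and the coefficient is at least [coef q a]. *)
  case: (pselect (exists g, S g /\ coef q (bd_sign P Minus (val g)) <> 0)).
    move=> [g [Sg gq]]; apply: le_trans (posb q) _.
    have -> : b = a + bd n x by rewrite E addrC subrK.
    rewrite raddfD /= coef_bd lerD2l /flux -sumrB; apply: ler_sum => h _.
    rewrite -mulrBr -/(d q h) /f; case: asboolP => // nSh.
    rewrite mul0r mulr_ge0_le0 //.
    rewrite /d (_ : coef q (bd_sign P Plus (val h)) = 0).
      by rewrite sub0r oppr_le0 bd_sign_ge0.
    by apply: contrapT => hq; apply/nSh/(S_down g h q).
  move=> no; rewrite addr_ge0 // sumr_ge0 // => g _; rewrite /f.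
  case: asboolP => Sg; last by rewrite mul0r.
  rewrite mulr_ge0 // dp //.
  by apply: contrapT => gq; apply: no; exists g.
have := le1 _ (cellular_shift ca py) p; rewrite ys; congr (_ + _ <= _).
(* An element of [S] with [p] in its source would both follow and equal or precede some [h] with [p]
   in its target, a loop at [h]. Outside [S], no target contains [p]. *)
apply: eq_bigr => g _; rewrite /f /d; case: asboolP => Sg.
  rewrite (_ : coef p (bd_sign P Minus (val g)) = 0) ?subr0 //.
  apply: contrapT => gp; case: Sg => h [hp gh].
  have hg := t_step _ _ _ _ (lt_step_face hp gp).
  apply: (hl (i := n) (x := in_total h)).
  by case: gh => [gh|gh]; [rewrite gh in hg | apply: t_trans hg gh].
rewrite mul0r (_ : coef p (bd_sign P Plus (val g)) = 0) ?mulr0 //.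
by apply: contrapT => gp; apply: Sg; exists g; split=> //; left.
Qed.

(** In positive degree, any [p] in the nonzero target of [g] satisfies [coef g x <= flux Plus x p].
    In degree 0, the coefficients are nonnegative with sum the augmentation. *)
Lemma cellular_coef_le1 n (x : K n) : cellular x -> forall g : P n, coef g x <= 1.
Proof.
elim: n x => [|n IH] x; last first.
  move=> [px [a [b [ca cb E]]]] g.
  have [p gp] := globe_neq0 (globe_bd_sign Plus (globe_basis g)).
  have := cellular_flux_le1 p IH px ca cb E.
  have := flux_ge_term Plus p g px.
  have /chain_posP/(_ p) := cellular_pos ca.
  have := bd_sign_ge0 Plus (val g) p.
  nia.
move=> [/chain_posP pos aug1] g.
have aE (h : P 0%N) : aug (val h) = 1 by have [_ /(_ Plus)] := globe_basis h.
move: aug1; rewrite {1}(sum_coef x) raddf_sum /=.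
under eq_bigr do rewrite raddfMz /= aE.
case: (boolP (g \in finsupp (coefs P x))) => [gA|/fsfun_dflt g0 _]; last first.
  by rewrite /coef g0.
rewrite (big_fsetD1 g) //= intz => <-; rewrite lerDl sumr_ge0 // => h _.
by rewrite intz.
Qed.

(** The equality carries the bound over to [flux Minus]. *)
Lemma cellular_flux n (x : K n.+1) : cellular x ->
  exists a b, [/\ cellular a, cellular b, bd n x = b - a
    & forall p : P n, coef p a + flux Plus x p = coef p b + flux Minus x p /\
                      coef p a + flux Plus x p <= 1].
Proof.
move=> [px [a [b [ca cb E]]]]; exists a, b; split=> // p; split.
  by move: (congr1 (coef p) E); rewrite coef_bd raddfB /=; lia.
exact: (cellular_flux_le1 p (@cellular_coef_le1 n) px ca cb E).
Qed.

(** * Supports of chains in the associated hypergraph *)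

Let H : hypergraph := hypergraph_of hP.

Definition supp n (y : K n) : set H :=
  [set t | exists g : P n, t = in_total g /\ coef g y <> 0].

Lemma in_total_inj n : injective (@in_total K P n).
Proof. by move=> g h E; exact: eq_from_Tagged E. Qed.

Lemma in_supp n (y : K n) (g : P n) : supp y (in_total g) <-> coef g y <> 0.
Proof.
split=> [[h [E gy]]|]; last by exists g.
by rewrite (in_total_inj E).
Qed.

Lemma supp_basis n (g : P n) : supp (val g) = [set in_total g].
Proof.
apply/seteqP; split=> [_ [h [-> hg]]|_ ->]; last first.
  by apply/in_supp; rewrite coef_basis eqxx.
by move: hg; rewrite coef_basis; case: eqP => [->|].
Qed.

Lemma supp_finite n (y : K n) : finite_set (supp y).
Proof.
apply: (@sub_finite_set _ _ (@in_total K P n @` [set` finsupp (coefs P y)])).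
  move=> _ [g [-> /eqP gy]]; exists g => //=.
  by rewrite mem_finsupp.
exact/finite_image/finite_fset.
Qed.

Lemma face_supp eps n (x : P n.+1) :
  face (h := H) eps (in_total x) = supp (bd_sign P eps (val x)).
Proof.
apply/seteqP; split=> [_ [g le <-]|_ [g [-> gx]]].
  apply/in_supp => z; have := le g.
  by rewrite -!/(coef g _) z coef_basis eqxx.
exists g => // h; rewrite -!/(coef h _) coef_basis.
case: eqP => [->|_]; last exact: bd_sign_ge0.
by have := bd_sign_ge0 eps (val x) g; lia.
Qed.

Lemma faces_supp eps n (x : K n.+1) (t : H) : faces eps (supp x) t ->
  exists p : P n, t = in_total p.
Proof. by case=> _ [g [-> _]]; rewrite face_supp => -[p [-> _]]; exists p. Qed.

Lemma in_faces eps n (x : K n.+1) (p : P n) : cellular x ->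
  faces eps (supp x) (in_total p) <-> 0 < flux eps x p.
Proof.
move=> /cellular_pos px; have /chain_posP pos := px; split.
  case=> _ [g [-> gx]]; rewrite face_supp => /in_supp gp.
  have := flux_ge_term eps p g px.
  by have := pos g; have := bd_sign_ge0 eps (val g) p; nia.
move=> lt; apply: contrapT => no; move: lt; rewrite /flux big1 // => g _.
case: (eqVneq (coef g x) 0) => [->|/eqP g0]; first by rewrite mul0r.
case: (eqVneq (coef p (bd_sign P eps (val g))) 0) => [->|/eqP p0].
  by rewrite mulr0.
by case: no; exists (in_total g); [exact/in_supp | rewrite face_supp; exact/in_supp].
Qed.

(** Both fluxes at [p] are 0 or 1, so their difference is positive exactly when one is 1 and the
    other 0, which is the set difference. Fluxes 2 and 1 would break this. *)
Lemma border_supp eps n (x : K n.+1) : cellular x ->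
  border eps (supp x) = supp (bd_sign P eps x).
Proof.
move=> cx; have px := cellular_pos cx.
have E (p : P n) :
    border eps (supp x) (in_total p) <-> supp (bd_sign P eps x) (in_total p).
  have [a [b [/cellular_pos/chain_posP/(_ p) pa /cellular_pos/chain_posP/(_ p) pb _]]] :=
    cellular_flux cx.
  move=> /(_ p) [E1 E2].
  have F1 := flux_ge0 Plus p px; have F2 := flux_ge0 Minus p px.
  have B1 := bd_sign_ge0 Plus x p; have B2 := bd_sign_ge0 Minus x p.
  have D := bd_sign_disjoint x p.
  have := congr1 (coef p) (bd_signE x); rewrite coef_bd raddfB /= => B.
  rewrite in_supp.
  case: eps; rewrite /border /setD /= !in_faces //; split; try lia;
    move=> ?; split; lia.
apply/seteqP; split=> t bt.
  have [p tp] : exists p : P n, t = in_total p.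
    by apply: (@faces_supp eps n x); case: eps bt {E} => -[].
  by rewrite tp; apply/E; rewrite -tp.
by case: (bt) => p [tp _]; rewrite tp; apply/E; rewrite -tp.
Qed.

(** The induction runs over globes, as the borders of [g] need not be basis elements. *)
Lemma atom_supp eps j k (g : P (k + j)%N) :
  atom (in_total g : H) j eps = supp (bracket P eps (val g)).
Proof.
rewrite /atom (_ : dim _ = k + j)%N // addnK -supp_basis.
have := globe_basis g; move: (val g) => x.
elim: k x {g} => [|k IH] x gx //.
by rewrite iterSr border_supp ?IH //; [exact: globe_bd_sign | exact: globe_cellular].
Qed.

(** * Atoms are cells *)

Lemma gradeP n (t : H) : grade n t -> exists g : P n, t = in_total g.
Proof. by case: t => m x /= E; case: _ / E; exists x. Qed.

Lemma total_degree j (t : H) : (j <= dim t)%N ->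
  exists k (g : P (k + j)%N), t = in_total g.
Proof.
case: t => n x /= jn; move: (n - j)%N (subnK jn) => k E {jn}.
by case: _ / E x => x; exists k, x.
Qed.

Lemma total_degreeS j (t : H) : (j < dim t)%N ->
  exists k (g : P (k.+1 + j)%N), t = in_total g.
Proof.
move=> /total_degree[k [g ->]].
by case: _ / (addSnnS k j) g => g; exists k, g.
Qed.

Definition parallel n : K n -> K n -> Prop :=
  match n with
  | 0%N => fun _ _ => True
  | n'.+1 => fun x y => bd n' x = bd n' y
  end.

Lemma parallel_bd_sign eps eps' n (x y : K n.+1) : bd n x = bd n y ->
  parallel (bd_sign P eps x) (bd_sign P eps' y).
Proof.
move=> xy; rewrite (eq_bd_sign eps xy); case: n y {x xy} => [|n] y //.
exact: bd_bd_sign.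
Qed.

Lemma parallel_bracket eps eps' j k (x y : K (k + j)%N) :
  parallel x y -> parallel (bracket P eps x) (bracket P eps' y).
Proof.
by elim: k x y => [|k IH] x y //= xy; apply/IH/parallel_bd_sign.
Qed.

(** An atom uses a single sign all the way down, whereas here the last sign may differ. The brackets
    of both signs are parallel, so [bd_sign P eps] agrees on them. *)
Lemma border_atom eps eps' n (t : H) : (n < dim t)%N ->
  border eps (atom t n.+1 eps') = atom t n eps.
Proof.
move=> nt; rewrite [RHS]/atom -subnSK // iterS -/(atom t n.+1 eps).
have [k [g ->]] := total_degree nt; rewrite !atom_supp.
have gg eps1 := globe_cellular (globe_bracket eps1 (globe_basis g)).
rewrite !border_supp // (@eq_bd_sign eps _ _ (bracket P eps (val g))) //.
apply: (@parallel_bracket eps' eps n.+1 k).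
by case: (k + n.+1)%N (val g).
Qed.

(** A face shared by two elements would have flux at least 2. In degree 0, two elements would make
    the augmentation at least 2. *)
Lemma fork_free_supp n (x : K n) : cellular x -> fork_free n (supp x).
Proof.
case: n x => [|n] x cx; have px := cellular_pos cx; have /chain_posP pos := px.
  have [_ aug1] := cx.
  have [g gx] : exists g : P 0%N, coef g x <> 0.
    by apply: globe_neq0; split=> //; case.
  exists (in_total g); apply/seteqP; split=> [_ [h [-> hx]]|_ ->]; last exact/in_supp.
  congr in_total; apply: contrapT => hg; move: aug1; rewrite {1}(sum_coef x).
  rewrite raddf_sum /=.
  have mem k : coef k x <> 0 -> k \in finsupp (coefs P x).
    by move/eqP; rewrite mem_finsupp.
  have aE (k : P 0%N) : aug (val k) = 1 by have [_ /(_ Plus)] := globe_basis k.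
  under eq_bigr do rewrite raddfMz /= aE intz.
  rewrite (big_fsetD1 g) ?mem //= (big_fsetD1 h) /=; last first.
    by rewrite !inE mem // andbT; apply/eqP.
  set s := \sum_(_ <- _) _; have : 0 <= s by rewrite /s sumr_ge0.
  by have := pos g; have := pos h; lia.
move=> _ _ [g [-> gx]] [h [-> hx]] gh eps.
apply/seteqP; split=> // t []; rewrite !face_supp => -[p [-> gp]] /in_supp hp.
have [a [b [/cellular_pos/chain_posP/(_ p) pa /cellular_pos/chain_posP/(_ p) pb _]]] :=
  cellular_flux cx.
move=> /(_ p) [E1 E2].
have F : flux eps x p <= 1 by case: eps {gp hp}; lia.
have gh' : g <> h by move=> E; apply: gh; rewrite E.
have := flux_ge_two_terms eps p px gh'.
have := bd_sign_ge0 eps (val g) p; have := bd_sign_ge0 eps (val h) p.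
have := pos g; have := pos h.
move: (coef g x) (coef h x) (coef p _) (coef p _) gx hx gp hp.
nia.
Qed.

Lemma moves_border M : moves (P := H) M (border Minus M) (border Plus M).
Proof.
by split; apply/seteqP; split=> t /=; rewrite /setD /setU /=; tauto.
Qed.

Lemma atom_cell (u : H) : is_cell (dim u) (atom u).
Proof.
split.
- split; last by rewrite /atom subnn.
  move=> i eps /total_degree[k [g ->]]; rewrite atom_supp.
  split; first exact: supp_finite.
  by move=> _ [h [-> _]].
- move=> i eps iu; rewrite -(border_atom Minus eps iu) -(border_atom Plus eps iu).
  exact: moves_border.
- move=> i eps /total_degree[k [g ->]]; rewrite atom_supp.
  exact/fork_free_supp/globe_cellular/globe_bracket/globe_basis.
Qed.

(** * Collapsing atoms: segments and torsion-freeness *)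

Lemma lt_step_atom n (u v z : H) : (n < dim u)%N -> (n < dim v)%N ->
  atom u n Plus z -> atom v n Minus z -> lt_step n u v.
Proof.
move=> /total_degreeS[k [x ->]] /total_degreeS[k' [y ->]].
rewrite !atom_supp => -[p [-> xp]] /in_supp yp.
apply: (@LtStep _ P n k k' x y).
apply: (meet_neq0 _ _ xp yp).
  by have [] := globe_bracket (j := n) (k := k.+1) Plus (globe_basis x).
by have [] := globe_bracket (j := n) (k := k'.+1) Minus (globe_basis y).
Qed.

(* [r] collapses disjoint atoms [<t>_{n+1,eps}] of [U] to points [(t, eps)]:
   a step leaving one atom for another leaves through the target border of the
   first one and enters through the source border of the second one. *)
Lemma triangle_collapse n (U : set H) (r : H -> H * sign) :
  fork_free n.+1 U ->
  (forall w, U w -> (n < dim (r w).1)%N /\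
     atom (r w).1 n.+1 (r w).2 = [set w' | U w' /\ r w' = r w]) ->
  forall y w, triangle U y w -> r y = r w \/ lt_basis n (r y).1 (r w).1.
Proof.
move=> ff rU y w; elim=> {y w} [y w [Uy Uw [z [zy zw]]]|y w v _ IH1 _ IH2].
  case: (pselect (r y = r w)) => [|yw]; [by left | right; apply: t_step].
  have [ny Ey] := rU _ Uy; have [nw Ew] := rU _ Uw.
  apply: (@lt_step_atom n _ _ z) => //.
    (* The point [z] survives in the target border of the block of [y]: by fork-freeness only [w]
       has it in its source, and [w] lies in another block. The source border is dual. *)
    rewrite -(border_atom _ (r y).2 ny) Ey; split; first by exists y.
    case=> w' [Uw' E] zw'; apply: yw; rewrite -E; congr r.
    apply: contrapT => ww; have := ff _ _ Uw' Uw ww Minus.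
    by move/seteqP => [/(_ z) + _]; apply.
  rewrite -(border_atom _ (r w).2 nw) Ew; split; first by exists w.
  case=> y' [Uy' E] zy'; apply: yw; rewrite -E; congr r.
  apply: contrapT => ww; have := ff _ _ Uy Uy' ww Plus.
  by move/seteqP => [/(_ z) + _]; apply.
case: IH1 => [->|lt1] //; case: IH2 => [<-|lt2]; first by right.
by right; apply: t_trans lt1 lt2.
Qed.

Lemma atom_top (w : H) n eps : dim w = n -> atom w n eps = [set w].
Proof. by rewrite /atom => ->; rewrite subnn. Qed.

Lemma triangle0 (U : set H) y w : U `<=` grade 0%N -> ~ triangle U y w.
Proof.
move=> U0; elim=> // {}y {}w [Uy _ [z [/face_dim + _]]].
by rewrite (U0 _ Uy).
Qed.

(** A path through some [u2] outside the atom collapses to a loop from [u] through [u2] back to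
    [u]. *)
Lemma atom_segment (u : H) n (U : set H) eps : (n < dim u)%N ->
  U `<=` grade n -> fork_free n U -> atom u n eps `<=` U ->
  segment U (atom u n eps).
Proof.
case: n => [|n] nu Un ff AU; split=> // u1 u2 u3 A1 A3 U2 t12 t23.
  by case: (triangle0 Un t12).
set A := atom _ _ _ in AU A1 A3 *.
(* Elements outside [A] are their own atoms, so their sign is arbitrary; [u] is no element of [U],
   for reasons of dimension, so the labels do not clash. *)
pose r w : H * sign := if `[< A w >] then (u, eps) else (w, Minus).
have ne w : U w -> w <> u by move=> /Un E wu; move: nu; rewrite -wu E ltnn.
have rU w : U w -> (n < dim (r w).1)%N /\
    atom (r w).1 n.+1 (r w).2 = [set w' | U w' /\ r w' = r w].
  move=> Uw; rewrite /r; case: asboolP => Aw /=.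
    split; first exact: ltnW.
    apply/seteqP; split=> [w' Aw'|w' [Uw']].
      by split; [exact: AU | case: asboolP].
    by case: asboolP => // _ [/ne]; case.
  split; first by have := Un _ Uw; rewrite /grade /= => ->.
  rewrite (atom_top _ (Un _ Uw)); apply/seteqP; split=> [_ ->|w' [Uw']].
    by split=> //; case: asboolP.
  by case: asboolP => [_ [/esym/ne]|_ []].
apply: contrapT => A2.
have r1 : r u1 = (u, eps) by rewrite /r; case: asboolP.
have r2 : r u2 = (u2, Minus) by rewrite /r; case: asboolP.
have r3 : r u3 = (u, eps) by rewrite /r; case: asboolP.
have u2u := ne _ U2.
have [|lt1] := triangle_collapse ff rU t12; first by rewrite r1 r2 => -[/esym].
have [|lt2] := triangle_collapse ff rU t23; first by rewrite r2 r3 => -[].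
rewrite r1 r2 in lt1; rewrite r2 r3 in lt2.
exact: hl (t_trans _ _ _ _ _ lt1 lt2).
Qed.

Lemma atoms_torsion_free (u v : H) n (U : set H) :
  (n.+1 < dim u)%N -> (n.+1 < dim v)%N ->
  U `<=` grade n.+1 -> fork_free n.+1 U ->
  atom u n.+1 Plus `<=` U -> atom v n.+1 Minus `<=` U ->
  atom u n.+1 Plus `&` atom v n.+1 Minus = set0 ->
  triangle_set U (atom u n.+1 Plus) (atom v n.+1 Minus) ->
  triangle_set U (atom v n.+1 Minus) (atom u n.+1 Plus) -> False.
Proof.
move=> nu nv Un ff AU BU AB.
set A := atom u _ _ in AU AB *; set B := atom v _ _ in BU AB *.
(* The signs keep the two blocks apart even when [u = v]. *)
pose r w : H * sign := if `[< A w >] then (u, Plus) else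
                       if `[< B w >] then (v, Minus) else (w, Minus).
have dis w : A w -> B w -> False.
  by move=> Aw Bw; move/seteqP: AB => [/(_ w) + _]; apply.
have rA w : A w -> r w = (u, Plus) by rewrite /r; case: asboolP.
have rB w : B w -> r w = (v, Minus).
  move=> Bw; rewrite /r; case: asboolP => [/dis|_]; first by case/(_ Bw).
  by case: asboolP.
have rC w : ~ A w -> ~ B w -> r w = (w, Minus).
  by rewrite /r; do 2 case: asboolP => //.
have neu w : U w -> w <> u by move=> /Un E wu; move: nu; rewrite -wu E ltnn.
have nev w : U w -> w <> v by move=> /Un E wv; move: nv; rewrite -wv E ltnn.
have cases w : [\/ A w, B w | ~ A w /\ ~ B w].
  case: (pselect (A w)) => Aw; first by constructor 1.
  by case: (pselect (B w)) => Bw; [constructor 2 | constructor 3].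
have rU w : U w -> (n < dim (r w).1)%N /\
    atom (r w).1 n.+1 (r w).2 = [set w' | U w' /\ r w' = r w].
  move=> Uw; case: (cases w) => [Aw|Bw|[nA nB]].
  - rewrite rA //=; split; first exact: ltnW.
    apply/seteqP; split=> [w' Aw'|w' [Uw']]; first by split; [exact: AU | exact: rA].
    by case: (cases w') => [//|Bw'|[nA nB]]; [rewrite rB | rewrite rC].
  - rewrite rB //=; split; first exact: ltnW.
    apply/seteqP; split=> [w' Bw'|w' [Uw']]; first by split; [exact: BU | exact: rB].
    case: (cases w') => [Aw'|//|[nA nB]]; [by rewrite rA | rewrite rC //].
    by case=> /(nev _ Uw').
  - rewrite rC //=; split; first by have := Un _ Uw; rewrite /grade /= => ->.
    rewrite (atom_top _ (Un _ Uw)); apply/seteqP; split=> [_ ->|w' [Uw']].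
      by split=> //; exact: rC.
    case: (cases w') => [Aw'|Bw'|[nA' nB']]; [by rewrite rA | rewrite rB // | rewrite rC //].
      by case=> /esym/(nev _ Uw).
    by case.
move=> [a [b [Aa Bb ab]]] [b' [a' [Bb' Aa' ba]]].
have [|lt1] := triangle_collapse ff rU ab; first by rewrite rA ?rB.
have [|lt2] := triangle_collapse ff rU ba; first by rewrite rB ?rA.
rewrite rA ?rB //= in lt1; rewrite rB ?rA //= in lt2.
exact: hl (t_trans _ _ _ _ _ lt1 lt2).
Qed.

(** * Verification of the axioms *)

Lemma cell_top n (X : nat -> sign -> set H) : is_cell n X ->
  top n X `<=` grade n /\ fork_free n (top n X).
Proof.
move=> [[pre _] _ ff]; split; last exact: ff.
by have [] := pre n Minus (leqnn n).
Qed.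

Lemma torsion_free_hypergraph_of : torsion_free_complex H.
Proof.
split.
- move=> [[|n] x] eps // _.
  have [p xp] := globe_neq0 (globe_bd_sign eps (globe_basis x)).
  by exists (in_total p); rewrite face_supp; apply/in_supp.
- move=> [|n] // _ u uu; apply: (hl (i := n) (x := u)).
  suff tri v w : triangle (grade (P := H) n.+1) v w -> lt_basis n v w by exact: tri.
  elim=> {u uu v w} [u v [gu gv [z]]|u v w _ uv _ vw]; last exact: t_trans uv vw.
  case/gradeP: gu => x ->; case/gradeP: gv => y ->; rewrite !face_supp.
  case=> -[p [-> xp]] /in_supp yp; apply: t_step.
  exact: lt_step_face xp yp.
- exact: atom_cell.
- move=> u n X eps nu /cell_top[Xn ff]; exact: atom_segment.
- move=> [[|n] [u [v [X [[n1 nuv cX] [AU BU AB uv vu]]]]]] //.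
  have [Xn ff] := cell_top cX.
  move: nuv; rewrite leq_min => /andP[nu nv].
  exact: (@atoms_torsion_free u v n (top n.+1 X)).
Qed.

End Coefficients.

Theorem mainTheorem10 (K : adc) (P : graded_set K) (hP : is_basis P)
    (hu : unital P) (hl : loop_free P) :
  torsion_free_complex (hypergraph_of hP).
Proof. exact: torsion_free_hypergraph_of hu hl. Qed.
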